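(* Consider the composite convex nonsmooth minimization problem $$\min_{x\in\mathbb{R}^d}\ \varphi(x):=f(x_1,\dots,x_p)+\sum_{j=1}^pg_j(x_j),$$ where $x=(x_1,\dots,x_p)\in\mathbb{R}^d$ with $j$-th block $x_j\in\mathbb{R}^{d_j}$ and $d=\sum_{j=1}^pd_j$. Set $g(x):=\sum_{j=1}^pg_j(x_j)$, so that $\mathrm{dom}\,g=\prod_{j=1}^p\mathrm{dom}\,g_j$ and $\varphi=f+g$. Let $L$ and $L_j$, $j=1,\dots,p$, be positive constants. Assume that: - $f\in\mathcal{F}^{1,1}_L(\mathbb{R}^d)$, $g_j\in\Gamma_0(\mathbb{R}^{d_j})$ for $j=1,\dots,p$, and $\Omega\subset\mathrm{dom}\,\partial\varphi$; - for each $j=1,\dots,p$, the function $x_j\mapsto f(x_{1:(j-1)},x_j,x_{(j+1):p})$ belongs to $\mathcal{F}^{1,1}_{L_j}(\mathbb{R}^{d_j})$ for all $x_{1:(j-1)}$ and $x_{(j+1):p}$; - $\varphi=f+g$ achieves its minimum $\min\varphi$; - $\varphi$ satisfies the $(\partial^0\varphi,\eta,\Omega)$-(res-obj-EB) condition (or one of its equivalent conditions (cor-EB), (res-EB), (obj-EB), all taken with the operator $\partial^0\varphi$ on $\Omega$, the equivalence being for $\partial\varphi$-invariant $\Omega$), which is strictly weaker than strong convexity. Let $\{x^{(t)}\}_{t\ge0}$ be generated by PALM and assume that $x^{(t)}\in\Omega$ for all $t\ge0$. Then PALM converges linearly in the sense that $$\varphi(x^{(t+1)})-\min\varphi\le\left(\frac{\eta^2L_{\min}}{4pL^2+4L_{\max}^2}+1\right)^{-1}(\varphi(x^{(t)})-\min\varphi),\quad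 t\ge0,$$ where $L_{\min}=\min_jL_j$ and $L_{\max}=\max_jL_j$.
   Context: $\mathcal{F}^{1,1}_L(\mathbb{R}^n)$ is the class of differentiable convex functions $\mathbb{R}^n\to\mathbb{R}$ whose gradient is Lipschitz continuous with modulus $L$; $\Gamma_0(\mathbb{R}^n)$ is the class of proper lower semicontinuous convex functions $\mathbb{R}^n\to(-\infty,+\infty]$. $\mathrm{dom}\,\varphi=\{x:\varphi(x)<+\infty\}$; $\partial\varphi$ is the convex subdifferential, $\mathrm{dom}\,\partial\varphi=\{x:\partial\varphi(x)\ne\emptyset\}\subset\mathrm{dom}\,\varphi$, and for $x\in\mathrm{dom}\,\partial\varphi$, $\partial^0\varphi(x)$ is the least-norm element of $\partial\varphi(x)$. $\mathrm{crit}\,\varphi=\{x:0\in\partial\varphi(x)\}=\mathrm{Arg}\min\varphi$, $d(x,Q)=\inf_{y\in Q}\|x-y\|$, and $x_p$ denotes the projection of $x$ onto $\mathrm{crit}\,\varphi$. Error bound (EB) conditions, each required for all $x\in\Omega$: - $(\partial^0\varphi,\eta,\Omega)$-(res-obj-EB), $\eta>0$: $\|\partial^0\varphi(x)\|\ge\eta\sqrt{\varphi(x)-\min\varphi}$; - $(\partial^0\varphi,\kappa,\Omega)$-(res-EB), $\kappa>0$: $\|\partial^0\varphi(x)\|\ge\kappa\, d(x,\mathrm{crit}\,\varphi)$; - $(\partial^0\varphi,\nu,\Omega)$-(cor-EB), $\nu>0$: $\langle\partial^0\varphi(x),x-x_p\rangle\ge\nu\, d^2(x,\mathrm{crit}\,\varphi)$;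 - $(\varphi,\alpha,\Omega)$-(obj-EB), $\alpha>0$: $\varphi(x)-\min\varphi\ge\frac{\alpha}{2}d^2(x,\mathrm{crit}\,\varphi)$. These four conditions are equivalent (up to the values of the constants) when $\Omega\subset\mathrm{dom}\,\partial\varphi$ is $\partial\varphi$-invariant, meaning: for every $x\in\Omega\cap\mathrm{dom}\,\partial\varphi$, the unique absolutely continuous curve $\chi_x:[0,\infty)\to\mathbb{R}^d$ with $\chi_x(0)=x$ and $\dot\chi_x(t)\in-\partial\varphi(\chi_x(t))$ for almost every $t>0$ satisfies $\chi_x(t)\in\Omega$ for almost every $t>0$. The constant $\eta$ in the rate is that of the (res-obj-EB) condition. Notation: $x_{1:k}=(x_1,\dots,x_k)$, $x_{1:(j-1)}^{(t+1)}=(x_1^{(t+1)},\dots,x_{j-1}^{(t+1)})$, $x_{(j+1):p}^{(t)}=(x_{j+1}^{(t)},\dots,x_p^{(t)})$, and $\psi_j^{(t)}(x_j)=f(x_{1:(j-1)}^{(t+1)},x_j,x_{(j+1):p}^{(t)})$. PALM (proximal alternating linearized minimization): given initial points $\{x_j^{(0)}\}_{j=1}^p$, for $t\ge0$ and successively $j=1,\dots,p$, $$x_j^{(t+1)}=\arg\min_{x_j}\left\{\langle x_j-x_j^{(t)},\nabla\psi_j^{(t)}(x_j^{(t)})\rangle+\frac{L_j}{2}\|x_j-x_j^{(t)}\|^2+g_j(x_j)\right\},$$ and $x^{(t)}=(x_1^{(t)},\dots,x_p^{(t)})$. *)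

(* Defs.v *)
From HB Require Import structures.
From mathcomp Require Import all_boot all_order all_algebra.
From mathcomp Require Import all_classical all_reals all_analysis.

Set Implicit Arguments.
Unset Strict Implicit.
Unset Printing Implicit Defensive.

Import Order.TTheory GRing.Theory Num.Theory.
Import numFieldNormedType.Exports.

Local Open Scope classical_set_scope.
Local Open Scope ring_scope.

(* The topology and the derivatives on ['rV[R]_n] are the library's (its norm
   is the sup norm, which is equivalent to the Euclidean one); all metric
   quantities below use the Euclidean norm [enorm]. *)
Section Euclidean.
Context {R : realType} {n : nat}.
Implicit Types (x y u v : 'rV[R]_n) (Q : set 'rV[R]_n).

Definition dot u v : R := (u *m v^T) 0 0.
Definition enorm u : R := Num.sqrt (dot u u).

(* These two are meaningful for nonempty [Q] (nonempty, closed and convex for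
   the projection); [projection Q x] is [0] if no nearest point exists. *)
Definition dist x Q : R := inf [set enorm (x - y) | y in Q].
Definition projection Q x : 'rV[R]_n :=
  xget 0 [set y | Q y /\ forall z, Q z -> enorm (x - y) <= enorm (x - z)].

Definition grad (f : 'rV[R]_n -> R) x : 'rV[R]_n :=
  \row_(i < n) 'D_(delta_mx 0 i) f x.

Definition F11 (L : R) (f : 'rV[R]_n -> R) : Prop :=
  [/\ convex_function [set: 'rV[R]_n] f,
      forall x, differentiable f x &
      forall x y, enorm (grad f x - grad f y) <= L * enorm (x - y)].

End Euclidean.

Section ConvexAnalysis.
Context {R : realType} {n : nat}.
Implicit Types (phi : 'rV[R]_n -> \bar R) (x y v : 'rV[R]_n).
Implicit Types Omega : set 'rV[R]_n.
Local Open Scope ereal_scope.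

Definition edom phi : set 'rV[R]_n := [set x | phi x < +oo].

Definition econvex phi : Prop :=
  forall (t : R) x y, (0 <= t <= 1)%R ->
    phi (t *: x + (1 - t) *: y)%R <= t%:E * phi x + (1 - t)%R%:E * phi y.

Definition strongly_convex (mu : R) phi : Prop :=
  forall (t : R) x y, (0 <= t <= 1)%R ->
    phi (t *: x + (1 - t) *: y)%R + (mu / 2 * t * (1 - t) * enorm (x - y) ^+ 2)%R%:E
      <= t%:E * phi x + (1 - t)%R%:E * phi y.

Definition Gamma0 phi : Prop :=
  [/\ forall x, -oo < phi x, edom phi !=set0,
      lower_semicontinuous phi & econvex phi].

Definition is_argmin phi x : Prop := forall y, phi x <= phi y.
Definition attains_min phi : Prop := exists x, is_argmin phi x.
Definition minval phi : \bar R := ereal_inf (range phi).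

(* For proper [phi], a point with a subgradient lies in [edom phi]. *)
Definition subdiff phi x : set 'rV[R]_n :=
  [set v | forall y, phi x + (dot v (y - x)%R)%:E <= phi y].
Definition dom_subdiff phi : set 'rV[R]_n := [set x | subdiff phi x !=set0].
Definition crit phi : set 'rV[R]_n := [set x | subdiff phi x 0%R].

(* The least-norm subgradient; [0] outside [dom_subdiff phi], where it is not
   meaningful. *)
Definition subgrad0 phi x : 'rV[R]_n :=
  xget 0%R [set v | subdiff phi x v /\
                    forall w, subdiff phi x w -> (enorm v <= enorm w)%R].

Definition res_obj_EB phi (eta : R) Omega : Prop :=
  forall x, Omega x ->
    eta%:E * sqrte (phi x - minval phi) <= (enorm (subgrad0 phi x))%:E.

Definition res_EB phi (kappa : R) Omega : Prop :=
  forall x, Omega x ->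
    (kappa * dist x (crit phi) <= enorm (subgrad0 phi x))%R.

Definition cor_EB phi (nu : R) Omega : Prop :=
  forall x, Omega x ->
    (nu * dist x (crit phi) ^+ 2
       <= dot (subgrad0 phi x) (x - projection (crit phi) x))%R.

Definition obj_EB phi (alpha : R) Omega : Prop :=
  forall x, Omega x ->
    (alpha / 2 * dist x (crit phi) ^+ 2)%R%:E <= phi x - minval phi.

Definition abs_continuous_on (T : R) (chi : R -> 'rV[R]_n) : Prop :=
  forall e : R, (0 < e)%R -> exists2 delta : R, (0 < delta)%R &
    forall (m : nat) (a b : 'I_m -> R),
      (forall i, [/\ 0 <= a i, a i <= b i & b i <= T]%R) ->
      trivIset setT (fun i => `]a i, b i[%classic) ->
      (\sum_i (b i - a i) < delta)%R ->
      (\sum_i enorm (chi (b i) - chi (a i)) < e)%R.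

(* A curve on [0, +oo[ (its values at negative times are irrelevant),
   absolutely continuous on every compact interval. *)
Definition subgradient_flow phi x (chi : R -> 'rV[R]_n) : Prop :=
  [/\ forall T : R, abs_continuous_on T chi,
      chi 0%R = x &
      {ae (@lebesgue_measure R), forall t : R, (0 < t)%R ->
         derivable chi t 1%R /\ subdiff phi (chi t) (- derive1 chi t)%R}].

(* The flow from a point of [dom_subdiff phi] exists and is unique when [phi]
   is in [Gamma0], so the quantifier over [chi] ranges over one curve (up to
   its values at negative times). *)
Definition subdiff_invariant phi Omega : Prop :=
  forall x, Omega x -> dom_subdiff phi x ->
  forall chi, subgradient_flow phi x chi ->
    {ae (@lebesgue_measure R), forall t : R, (0 < t)%R -> Omega (chi t)}.

End ConvexAnalysis.

(* [R^d] with [d = \sum_j dd j]; the [j]-th block of [x] is [submxrow x j]. *)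
Section Blocks.
Context {R : realType} {p : nat} {dd : 'I_p -> nat}.
Local Notation Rd := 'rV[R]_(\sum_(j < p) dd j).
Implicit Types (f : Rd -> R) (g : forall j, 'rV[R]_(dd j) -> \bar R).
Implicit Types (x y : Rd) (L eta : R) (Lb : 'I_p -> R).

Definition composite f g : Rd -> \bar R :=
  fun x => ((f x)%:E + \sum_(j < p) g j (submxrow x j))%E.

(* [(y_1, .., y_(j-1), u, x_(j+1), .., x_p)] *)
Definition splice y x (j : 'I_p) (u : 'rV[R]_(dd j)) : Rd :=
  \mxrow_(k < p)
    eqtype.dfwith (fun k : 'I_p => if (k < j)%N then submxrow y k else submxrow x k)
      u k.

Definition composite_problem f g L Lb : Prop :=
  [/\ F11 L f,
      forall j, Gamma0 (g j),
      forall x j, F11 (Lb j) (fun u => f (@splice x x j u)) &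
      attains_min (composite f g)].

Definition palm f g Lb (x : nat -> Rd) : Prop :=
  forall t (j : 'I_p),
    let psi u := f (@splice (x t.+1) (x t) j u) in
    let xj := submxrow (x t) j in
    is_argmin
      (fun u => ((dot (u - xj) (grad psi xj)
                  + Lb j / 2 * enorm (u - xj) ^+ 2)%R%:E + g j u)%E)
      (submxrow (x t.+1) j).

Definition Lmin (hp : (0 < p)%N) Lb : R :=
  \big[Num.min/Lb (Ordinal hp)]_(j < p) Lb j.
Definition Lmax (hp : (0 < p)%N) Lb : R :=
  \big[Num.max/Lb (Ordinal hp)]_(j < p) Lb j.

Definition palm_factor (hp : (0 < p)%N) L Lb eta : R :=
  (eta ^+ 2 * Lmin hp Lb / (4 * p%:R * L ^+ 2 + 4 * Lmax hp Lb ^+ 2) + 1)^-1.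

End Blocks.

(* Main.v *)
Require Import Defs.
From HB Require Import structures.
From mathcomp Require Import all_boot all_order all_algebra.
From mathcomp Require Import all_classical all_reals all_analysis.
From mathcomp Require Import ring lra.

Set Implicit Arguments.
Unset Strict Implicit.
Unset Printing Implicit Defensive.

Import Order.TTheory GRing.Theory Num.Theory.
Import numFieldNormedType.Exports.

Local Open Scope classical_set_scope.
Local Open Scope ring_scope.

(** The rate comes from three estimates on one PALM sweep, from [x] to [y], with
    [D] the squared Euclidean length of [y - x].

    Sufficient decrease: [phi y + Lmin / 2 * D <= phi x].  The new block
    minimizes a [g j] plus a quadratic, so it carries an explicit subgradient of
    [g j] ([prox_subgradient]); that subgradient inequality, added to the descent
    lemma for the partial function of [f], bounds the change of the objective in
    block [j] ([prox_decrease]), and the changes telescope along the points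
    [mix y x k] whose first [k] blocks are already updated ([sweep_decrease]).

    Small subgradient: the subgradients of the [g j] found above, added to the
    gradient of [f] at [y], form a subgradient [v] of [phi] at [y].  Block [j] of
    [v] is the block [j] of [grad f y - grad f (mix y x j)], minus [Lb j] times
    the displacement of block [j].  Since [mix y x j] is no further from [y] than
    [x] is, the Lipschitz continuity of [grad f] bounds the squared norm of [v]
    by [(2 p L^2 + 2 Lmax^2) D] ([sweep_subgradient]).

    Error bound: the least-norm subgradient at [y] is no longer than [v], so
    (res-obj-EB) at [y] turns the second estimate into
    [eta^2 (phi y - min phi) <= (2 p L^2 + 2 Lmax^2) D], and the first one
    replaces [D] by a multiple of [phi x - phi y]; solving for [phi y - min phi]
    gives the factor ([palm_linear_rate]).

    Each of the other three error bounds implies (res-obj-EB) point by point,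
    through [phi x - min phi <= |v| d(x, crit phi)] for a subgradient [v] at [x]
    ([gap_le_dist]).  Strong convexity implies it as well: compare [phi] at [x],
    at a minimizer and at their midpoint.  The zero function satisfies
    (res-obj-EB) and, in positive dimension, is not strongly convex. *)

(** * Euclidean geometry *)

Section EuclideanTheory.
Context {R : realType} {n : nat}.
Implicit Types (x y u v w : 'rV[R]_n) (Q : set 'rV[R]_n).

Lemma dotE u v : dot u v = \sum_i u 0 i * v 0 i.
Proof. by rewrite /dot mxE; apply: eq_bigr => i _; rewrite mxE. Qed.

Lemma dotC u v : dot u v = dot v u.
Proof. by rewrite !dotE; apply: eq_bigr => i _; rewrite mulrC. Qed.

Lemma dotDl u v w : dot (u + v) w = dot u w + dot v w.
Proof. by rewrite /dot mulmxDl mxE. Qed.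

Lemma dotNl u w : dot (- u) w = - dot u w.
Proof. by rewrite /dot mulNmx mxE. Qed.

Lemma dotZl (a : R) u w : dot (a *: u) w = a * dot u w.
Proof. by rewrite /dot -scalemxAl mxE. Qed.

Lemma dotDr u v w : dot w (u + v) = dot w u + dot w v.
Proof. by rewrite dotC dotDl !(dotC w). Qed.

Lemma dotNr u w : dot w (- u) = - dot w u.
Proof. by rewrite dotC dotNl dotC. Qed.

Lemma dotZr (a : R) u w : dot w (a *: u) = a * dot w u.
Proof. by rewrite dotC dotZl dotC. Qed.

Lemma dot0l w : dot 0 w = 0.
Proof. by rewrite -(scale0r 0) dotZl mul0r. Qed.

Lemma dot0r w : dot w 0 = 0.
Proof. by rewrite dotC dot0l. Qed.

Definition dot_bilinear := (dotDl, dotDr, dotNl, dotNr, dotZl, dotZr).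

Lemma dot_ge0 u : 0 <= dot u u.
Proof. by rewrite dotE sumr_ge0 // => i _; rewrite -expr2 sqr_ge0. Qed.

Lemma dot_self_eq0 u : dot u u = 0 -> u = 0.
Proof.
rewrite dotE => /eqP; rewrite psumr_eq0; last by move=> i _; rewrite -expr2 sqr_ge0.
move=> /allP u0; apply/rowP => i; rewrite mxE; apply/eqP.
by have := u0 i; rewrite mem_index_enum mulf_eq0 orbb => /(_ isT).
Qed.

Lemma enorm_ge0 u : 0 <= enorm u. Proof. exact: sqrtr_ge0. Qed.

Lemma sqr_enorm u : enorm u ^+ 2 = dot u u.
Proof. by rewrite sqr_sqrtr // dot_ge0. Qed.

Lemma enormZ (s : R) u : 0 <= s -> enorm (s *: u) = s * enorm u.
Proof.
move=> s0; rewrite /enorm dotZl dotZr mulrA -expr2 sqrtrM ?sqr_ge0 // sqrtr_sqr.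
by rewrite ger0_norm.
Qed.

(** The squared norm of [enorm v *: u - enorm u *: v] is nonnegative. *)
Lemma cauchy_schwarz u v : dot u v <= enorm u * enorm v.
Proof.
have [a0 b0] := (enorm_ge0 u, enorm_ge0 v).
have [ua vb] := (sqr_enorm u, sqr_enorm v).
have [a1|a1] := eqVneq (enorm u) 0.
  by rewrite a1 mul0r (@dot_self_eq0 u) ?dot0l // -ua a1 expr0n.
have [b1|b1] := eqVneq (enorm v) 0.
  by rewrite b1 mulr0 (@dot_self_eq0 v) ?dot0r // -vb b1 expr0n.
have ab : 0 < enorm u * enorm v by rewrite mulr_gt0 // lt_neqAle eq_sym ?a1 ?b1.
have := dot_ge0 (enorm v *: u - enorm u *: v).
rewrite !dot_bilinear -ua -vb (dotC v u) => h.
rewrite -(ler_pM2l ab); move: h; set a := enorm u; set b := enorm v.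
by lra.
Qed.

Lemma coord_le_enorm u i : `|u 0 i| <= enorm u.
Proof.
rewrite -(@ler_pXn2r _ 2%N) ?nnegrE ?enorm_ge0 // sqr_enorm dotE real_normK ?num_real //.
by rewrite (bigD1 i) //= -expr2 lerDl sumr_ge0 // => j _; rewrite -expr2 sqr_ge0.
Qed.

Lemma continuous_dot (a b : 'rV[R]_n -> 'rV[R]_n) :
  continuous a -> continuous b -> continuous (fun x => dot (a x) (b x)).
Proof.
move=> ca cb.
rewrite (_ : (fun x => _) = (fun x => \sum_i a x 0 i * b x 0 i)); last first.
  by apply/funext => x; rewrite dotE.
apply: (@continuous_big R _ +%R 0 xpredT (@add_continuous R)) => i _ x.
apply: (@continuousM R _ (fun x => a x 0 i) (fun x => b x 0 i)).
- exact: (continuous_comp (ca x) (@coord_continuous R 1 n 0 i (a x))).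
- exact: (continuous_comp (cb x) (@coord_continuous R 1 n 0 i (b x))).
Qed.

Lemma continuous_enorm_sub x : continuous (fun y => enorm (x - y)).
Proof.
move=> y; apply: (@continuous_comp _ _ _ (fun y => dot (x - y) (x - y)) Num.sqrt).
  by apply: continuous_dot => z; apply: continuousB; 
    [exact: cst_continuous|exact: cvg_id|exact: cst_continuous|exact: cvg_id].
exact: sqrt_continuous.
Qed.

(** A minimizer over [Q] is sought in the part of [Q] no further from [x] than a
    given point of [Q]; the sup norm is at most the Euclidean norm, so that part
    is compact. *)
Lemma nearest_point x Q : closed Q -> Q !=set0 ->
  exists2 y, Q y & forall z, Q z -> enorm (x - y) <= enorm (x - z).
Proof.
move=> cQ [q Qq].
pose A := Q `&` [set y | enorm (x - y) <= enorm (x - q)].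
have Aq : A q by split => /=.
have cA : closed A.
  apply: closedI => //.
  exact: (preimage_closed (fun y _ => @continuous_enorm_sub x y) (@closed_le R _)).
have bA : bounded_set A.
  exists (`|x| + enorm (x - q)); split; first exact: num_real.
  move=> M hM y [_ /= hy].
  rewrite -[y](subKr x) (le_trans (ler_normB _ _)) // (le_trans _ (ltW hM)) // lerD2l.
  rewrite (le_trans _ hy) // [leLHS]mx_normrE; apply/bigmax_leP; split => [|[i j] _].
    exact: enorm_ge0.
  by rewrite /= ord1; exact: coord_le_enorm.
have cf : {within A, continuous (fun y => enorm (x - y))}.
  by apply: continuous_subspaceT; exact: continuous_enorm_sub.
have [y yA ymin] := EVT_min_rV (ex_intro _ q Aq) (bounded_closed_compact bA cA) cf.
move: yA; rewrite inE => -[Qy _]; exists y => // z Qz.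
have [zq|/ltW qz] := leP (enorm (x - z)) (enorm (x - q)).
  by apply: ymin; rewrite inE; split.
by apply: le_trans qz; apply: ymin; rewrite inE.
Qed.

Lemma projectionP x Q : closed Q -> Q !=set0 ->
  Q (projection Q x) /\ forall z, Q z -> enorm (x - projection Q x) <= enorm (x - z).
Proof.
move=> cQ Q0; have [y Qy ymin] := nearest_point x cQ Q0.
rewrite /projection; case: xgetP => [z -> //|/(_ y) []].
by split.
Qed.

(** The infimum defining [dist] is attained at the projection. *)
Lemma dist_projection x Q : closed Q -> Q !=set0 ->
  dist x Q = enorm (x - projection Q x).
Proof.
move=> cQ Q0; have [Qp pmin] := projectionP x cQ Q0.
apply/eqP; rewrite eq_le; apply/andP; split.
  apply: ge_inf; last by exists (projection Q x).
  by exists 0 => _ [y _ <-]; exact: enorm_ge0.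
apply: lb_le_inf; first by exists (enorm (x - projection Q x)), (projection Q x).
by move=> _ [y Qy <-]; exact: pmin.
Qed.

End EuclideanTheory.

(** * Convex functions with a Lipschitz gradient *)

Section SmoothConvex.
Context {R : realType} {n : nat}.
Implicit Types (f : 'rV[R]_n -> R) (x y d : 'rV[R]_n).

Lemma derive_dot_grad f x d : differentiable f x -> 'D_d f x = dot (grad f x) d.
Proof.
move=> df; rewrite dotE deriveE // {1}[d]row_sum_delta linear_sum.
by apply: eq_bigr => i _; rewrite linearZ mxE deriveE // mulrC.
Qed.

Lemma is_derive_line f x d (s : R) : differentiable f (x + s *: d) ->
  is_derive s 1 (fun r : R => f (x + r *: d)) (dot (grad f (x + s *: d)) d).
Proof.
move=> df; rewrite -derive_dot_grad //.
(* the two difference quotients are the same function of [h] *)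
have e : (fun h : R => h^-1 *:
      (((fun r : R => f (x + r *: d)) \o shift s) (h *: 1) - f (x + s *: d)))
   = (fun h => h^-1 *: ((f \o shift (x + s *: d)) (h *: d) - f (x + s *: d))).
  by apply/funext => h /=; rewrite [h *: 1]mulr1 scalerDl addrCA addrA.
have dv : derivable f (x + s *: d) d by exact: diff_derivable.
split; first by rewrite /derivable e.
by rewrite /derive e.
Qed.

(** The function [s |-> f (x + s *: d) - (s * c + K / 2 * s ^+ 2)] has a
    nonpositive derivative on the unit interval. *)
Lemma line_upper_bound f x d (c K : R) : (forall y, differentiable f y) ->
  (forall s, 0 < s < 1 -> dot (grad f (x + s *: d)) d <= c + K * s) ->
  f (x + d) <= f x + c + K / 2.
Proof.
move=> df hs.
pose h : R -> R := fun s => f (x + s *: d) - (s * c + K / 2 * s ^+ 2).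
have dh (s : R) : is_derive s 1 h (dot (grad f (x + s *: d)) d - (c + K * s)).
  have h1 := is_derive_line (df (x + s *: d)).
  apply: is_deriveB => //.
  apply: is_derive_eq.
  by rewrite /GRing.scale /=; lra.
have h10 : h 1 <= h 0.
  apply: (@ler0_derive1_le_cc R h 0 1) => [s _|s s01||||] //;
    rewrite ?in_itv /= ?lexx ?ler01 //.
    by rewrite derive1E derive_val subr_le0 hs // -in_itv.
  apply: continuous_subspaceT => s.
  by apply/differentiable_continuous/derivable1_diffP.
move: h10; rewrite /h scale1r scale0r addr0; lra.
Qed.

(** At [x + s *: (y - x)] the gradient differs from [grad f x] by at most
    [L * s * enorm (y - x)]. *)
Lemma descent_lemma f (L : R) x y : F11 L f ->
  f y <= f x + dot (grad f x) (y - x) + L / 2 * enorm (y - x) ^+ 2.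
Proof.
move=> [_ df lip].
have := @line_upper_bound f x (y - x) (dot (grad f x) (y - x)) (L * enorm (y - x) ^+ 2) df.
rewrite (addrC x (y - x)) subrK (_ : L * _ / 2 = L / 2 * enorm (y - x) ^+ 2); last by ring.
apply => s /andP[s0 s1].
rewrite -lerBlDl -dotNl -dotDl (le_trans (cauchy_schwarz _ _)) //.
have := lip (x + s *: (y - x)) x.
rewrite addrAC subrr add0r (enormZ _ (ltW s0)) => h.
apply: (le_trans (ler_wpM2r (enorm_ge0 _) h)).
by rewrite [leLHS](_ : _ = L * enorm (y - x) ^+ 2 * s) //; ring.
Qed.

(** Dividing by [s] and letting [s] tend to [0], without a limit: [a > 0] would
    be contradicted at [s = a / (a + K)].  First-order conditions are obtained
    from one-sided estimates through this lemma. *)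
Lemma le_of_le_small (a K : R) : (forall s, 0 < s <= 1 -> s * a <= s ^+ 2 * K) -> a <= 0.
Proof.
move=> h; rewrite leNgt; apply/negP => a0.
have K0 : 0 < K.
  by have := h 1; rewrite ltr01 lexx !(mul1r, expr1n) => /(_ isT); lra.
have aK : 0 < a + K by lra.
pose s := a / (a + K).
have s0 : 0 < s by rewrite divr_gt0.
have s1 : s <= 1 by rewrite ler_pdivrMr // mul1r lerDl ltW.
have sE : s * (a + K) = a by rewrite divfK // gt_eqF.
have := h s; rewrite s0 s1 => /(_ isT).
have -> : s ^+ 2 * K = s * a - s ^+ 2 * a by rewrite -[in X in s * X]sE; ring.
by have := mulr_gt0 (exprn_gt0 2 s0) a0; lra.
Qed.

Lemma convex_functionP f : convex_function [set: 'rV[R]_n] f ->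
  forall s x y, 0 <= s <= 1 -> f (s *: x + (1 - s) *: y) <= s * f x + (1 - s) * f y.
Proof.
move=> cf s x y /andP[s0 s1].
have := cf (Itv01 s0 s1) x y; rewrite !inE => /(_ Logic.I Logic.I).
by [].
Qed.

(** Convexity along the segment from [x] to [y] bounds [f] at [z = x + s *: d]
    from above.  The descent lemma from [z] back to [x], with [grad f z] replaced
    by [grad f x] at a cost of order [s ^+ 2], bounds it from below by the
    linearization at [x] up to [3 / 2 * L * s ^+ 2 * enorm d ^+ 2]. *)
Lemma gradient_inequality f (L : R) x y : F11 L f ->
  f x + dot (grad f x) (y - x) <= f y.
Proof.
move=> hf; have [cf _ lip] := hf.
rewrite -subr_le0 addrAC; set d := y - x.
apply: (@le_of_le_small _ (3 / 2 * L * enorm d ^+ 2)) => s /andP[s0 s1].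
set z := x + s *: d.
have zE : z = s *: y + (1 - s) *: x.
  by rewrite /z /d scalerBr scalerBl scale1r addrCA.
have h1 : f z <= s * f y + (1 - s) * f x by rewrite zE convex_functionP // ltW.
have h2 := descent_lemma z x hf.
have xz : x - z = - (s *: d) by rewrite /z opprD addrA subrr add0r.
have h3 : dot (grad f x - grad f z) d <= L * s * enorm d ^+ 2.
  rewrite (le_trans (cauchy_schwarz _ _)) // expr2 mulrA ler_wpM2r ?enorm_ge0 //.
  rewrite (le_trans (lip _ _)) // xz -scalerN (enormZ _ (ltW s0)) mulrA.
  by rewrite /enorm dotNl dotNr opprK.
have h4 := ler_wpM2l (ltW s0) h3.
have nz : enorm (x - z) ^+ 2 = s ^+ 2 * enorm d ^+ 2.
  by rewrite xz -scalerN !sqr_enorm !dot_bilinear; ring.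
move: h1 h2 h4; rewrite nz xz !dot_bilinear; set e := enorm d ^+ 2.
set a := dot _ _; set b := dot _ _.
nra.
Qed.

End SmoothConvex.

(** * Error bounds *)

Section ErrorBounds.
Context {R : realType} {n : nat}.
Variables (phi : 'rV[R]_n -> \bar R) (xm : 'rV[R]_n) (m : R).
Hypothesis xm_min : is_argmin phi xm.
Hypothesis phi_xm : phi xm = m%:E.
Implicit Types (x y v : 'rV[R]_n) (Omega : set 'rV[R]_n).

Lemma minval_argmin : minval phi = m%:E.
Proof.
rewrite -phi_xm; apply/eqP; rewrite eq_le; apply/andP; split.
  by apply: ereal_inf_lbound; exists xm.
by apply: le_ereal_inf_tmp => _ [y _ <-].
Qed.

Lemma phi_ge_min y : (m%:E <= phi y)%E.
Proof. by rewrite -phi_xm. Qed.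

Lemma dom_subdiff_fin x : dom_subdiff phi x -> exists2 r, phi x = r%:E & m <= r.
Proof.
move=> [v /(_ xm)]; rewrite phi_xm; have := phi_ge_min x.
by case: (phi x) => [r| |] //=; rewrite lee_fin; exists r.
Qed.

(** An intersection of closed half-spaces, one for each [y] with finite value. *)
Lemma closed_subdiff x (r : R) : phi x = r%:E -> closed (subdiff phi x).
Proof.
move=> xr; rewrite (_ : subdiff phi x =
    \bigcap_y [set v | ((r + dot v (y - x))%:E <= phi y)%E]); last first.
  apply/seteqP; split => v vx y; first by have := vx y; rewrite xr -EFinD.
  by rewrite xr -EFinD; exact: vx.
apply: closed_bigI => y _; have := phi_ge_min y.
case: (phi y) => [s _| _|//]; last first.
  rewrite (_ : [set v | _] = setT); first exact: closedT.
  by apply/seteqP; split => v //= _; rewrite leey.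
rewrite (_ : [set v | _] = (fun v => dot v (y - x)) @^-1` [set a | a <= s - r]).
  apply: preimage_closed (@closed_le R _) => v _.
  by apply: continuous_dot => z; [exact: cvg_id|exact: cst_continuous].
by apply/seteqP; split => v /=; rewrite lee_fin lerBrDl.
Qed.

(** A subdifferential is closed, so its point nearest to the origin exists. *)
Lemma subgrad0P x : dom_subdiff phi x -> subdiff phi x (subgrad0 phi x) /\
  forall w, subdiff phi x w -> enorm (subgrad0 phi x) <= enorm w.
Proof.
move=> dx; have [r xr _] := dom_subdiff_fin dx.
have [v vx vmin] := nearest_point 0 (closed_subdiff xr) dx.
rewrite /subgrad0; case: xgetP => [z -> //|/(_ v) []]; split => // w /vmin.
by rewrite !sub0r /enorm !(dotNl, dotNr) !opprK.
Qed.

Lemma critE : crit phi = [set x | phi x = m%:E].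
Proof.
apply/seteqP; split => x /=.
  rewrite /crit /= /subdiff /= => /(_ xm); rewrite dot0l adde0 phi_xm => h.
  by apply/eqP; rewrite eq_le h phi_ge_min.
by move=> xE y; rewrite dot0l adde0 xE phi_ge_min.
Qed.

Lemma closed_crit : lower_semicontinuous phi -> closed (crit phi).
Proof.
move=> /lower_semicontinuousP lsc.
rewrite (_ : crit phi = ~` [set x | (m%:E < phi x)%E]); first exact/open_closedC/lsc.
rewrite critE; apply/seteqP; split => x /=; first by move=> ->; rewrite ltxx.
by move=> /negP; rewrite -leNgt => h; apply/eqP; rewrite eq_le h phi_ge_min.
Qed.

(** Squaring removes the square root and the extended reals. *)
Lemma res_obj_EB_sqr (eta : R) Omega : 0 <= eta -> Omega `<=` dom_subdiff phi ->
  (res_obj_EB phi eta Omega <-> forall x r, Omega x -> phi x = r%:E ->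
     eta ^+ 2 * (r - m) <= enorm (subgrad0 phi x) ^+ 2).
Proof.
move=> eta0 Od; split => h x.
  move=> r Ox xr; have := h x Ox; rewrite minval_argmin xr /= -EFinM lee_fin => {}h.
  have rm : m <= r by rewrite -lee_fin -xr phi_ge_min.
  rewrite -[r - m]sqr_sqrtr ?subr_ge0 // -exprMn lerXn2r // nnegrE ?enorm_ge0 //.
  by rewrite mulr_ge0 // sqrtr_ge0.
move=> Ox; have [r xr rm] := dom_subdiff_fin (Od x Ox).
rewrite minval_argmin xr /= -EFinM lee_fin.
rewrite -(@ler_pXn2r _ 2) // ?nnegrE ?enorm_ge0 // ?mulr_ge0 ?sqrtr_ge0 //.
by rewrite exprMn sqr_sqrtr ?subr_ge0 //; exact: h.
Qed.

Lemma crit_neq0 : crit phi !=set0.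
Proof. by exists xm; rewrite critE. Qed.

Lemma dist_crit_ge0 x : lower_semicontinuous phi -> 0 <= dist x (crit phi).
Proof.
by move=> lsc; rewrite (dist_projection x (closed_crit lsc) crit_neq0) enorm_ge0.
Qed.

(** The subgradient inequality at [x], evaluated at the projection of [x] onto
    [crit phi], followed by Cauchy-Schwarz. *)
Lemma gap_le_dist x r v : lower_semicontinuous phi -> phi x = r%:E ->
  subdiff phi x v -> r - m <= enorm v * dist x (crit phi).
Proof.
move=> lsc xr vx.
have [cp _] := projectionP x (closed_crit lsc) crit_neq0.
rewrite (dist_projection x (closed_crit lsc) crit_neq0).
apply: le_trans (cauchy_schwarz _ _).
have := vx (projection (crit phi) x); move: cp; rewrite {1}critE /= => ->.
by rewrite xr -EFinD lee_fin !(dotDr, dotNr); lra.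
Qed.

(** With [G] the least subgradient norm and [D] the distance to [crit phi]:
    [kappa * (r - m) <= kappa * G * D <= G ^+ 2]. *)
Lemma res_EB_res_obj_EB (kappa : R) Omega : lower_semicontinuous phi ->
  Omega `<=` dom_subdiff phi -> 0 < kappa -> res_EB phi kappa Omega ->
  res_obj_EB phi (Num.sqrt kappa) Omega.
Proof.
move=> lsc Od k0 h; apply/(res_obj_EB_sqr (sqrtr_ge0 _) Od).
move=> x r Ox xr; rewrite sqr_sqrtr ?(ltW k0) //.
have [gx _] := subgrad0P (Od x Ox).
have gap := gap_le_dist lsc xr gx.
have := ler_wpM2l (enorm_ge0 (subgrad0 phi x)) (h x Ox).
have := ler_wpM2l (ltW k0) gap.
by lra.
Qed.

Lemma cor_EB_res_EB (nu : R) Omega : lower_semicontinuous phi ->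
  Omega `<=` dom_subdiff phi -> cor_EB phi nu Omega -> res_EB phi nu Omega.
Proof.
move=> lsc Od h x Ox.
have := le_trans (h x Ox) (cauchy_schwarz _ _).
rewrite -(dist_projection x (closed_crit lsc) crit_neq0) expr2 mulrA.
have [->|d0] := eqVneq (dist x (crit phi)) 0.
  by rewrite !mulr0 => _; exact: enorm_ge0.
by rewrite ler_pM2r // lt_neqAle eq_sym d0 dist_crit_ge0.
Qed.

(** With [G] and [D] as above, [(r - m) ^+ 2 <= G ^+ 2 * D ^+ 2] and
    [alpha / 2 * D ^+ 2 <= r - m]; divide by [r - m] when it is positive. *)
Lemma obj_EB_res_obj_EB (alpha : R) Omega : lower_semicontinuous phi ->
  Omega `<=` dom_subdiff phi -> 0 < alpha -> obj_EB phi alpha Omega ->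
  res_obj_EB phi (Num.sqrt (alpha / 2)) Omega.
Proof.
move=> lsc Od a0 h; apply/(res_obj_EB_sqr (sqrtr_ge0 _) Od).
move=> x r Ox xr; have a2 : 0 <= alpha / 2 by rewrite divr_ge0 // ltW.
rewrite sqr_sqrtr //.
have [gx _] := subgrad0P (Od x Ox).
have gap := gap_le_dist lsc xr gx.
have := h x Ox; rewrite minval_argmin xr lee_fin.
have rm : m <= r by rewrite -lee_fin -xr phi_ge_min.
move: gap; set D := dist _ _; set G := enorm _ => gap hD.
have [->|r0] := eqVneq r m; first by rewrite subrr mulr0 sqr_ge0.
have d0 : 0 < r - m by rewrite subr_gt0 lt_neqAle eq_sym r0.
have GD0 : 0 <= G * D by rewrite mulr_ge0 ?enorm_ge0 ?dist_crit_ge0.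
rewrite -(ler_pM2r d0).
have g2 : (r - m) ^+ 2 <= (G * D) ^+ 2 by rewrite lerXn2r // nnegrE ?(ltW d0).
have h1 := ler_wpM2l (sqr_ge0 G) hD.
have h2 := ler_wpM2l a2 g2.
by move: h1 h2; rewrite exprMn; lra.
Qed.

(** Strong convexity and the subgradient inequality at the midpoint of [x] and
    the minimizer [xm] give [r - m <= dot v (x - xm) - mu / 4 * |x - xm|^2], and
    completing the square bounds the right-hand side by [|v|^2 / mu]. *)
Lemma strongly_convex_res_obj_EB (mu : R) Omega : Omega `<=` dom_subdiff phi ->
  0 < mu -> strongly_convex mu phi -> res_obj_EB phi (Num.sqrt mu) Omega.
Proof.
move=> Od mu0 sc; apply/(res_obj_EB_sqr (sqrtr_ge0 _) Od).
move=> x r Ox xr; rewrite sqr_sqrtr ?(ltW mu0) //.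
have [gx _] := subgrad0P (Od x Ox); set v := subgrad0 phi x in gx *.
have h01 : 0 <= (2^-1 : R) <= 1 by apply/andP; split; lra.
have := sc 2^-1 xm x h01; rewrite xr phi_xm.
set mid : 'rV[R]_n := 2^-1 *: xm + _; have := gx mid; rewrite xr -EFinD => h1 h2.
have := le_trans (leeD2r _ h1) h2.
have -> : mid - x = 2^-1 *: (xm - x).
  by rewrite /mid scalerBl scale1r scalerBr addrCA [x + _]addrC addrK.
rewrite -!EFinM -!EFinD lee_fin sqr_enorm dotZr.
rewrite sqr_enorm; move: (xm - x) (v) => d w h.
(* the completed square; [d] stands for [xm - x] *)
have := dot_ge0 (w + (mu / 2) *: d); rewrite !dot_bilinear (dotC d w).
have := mulr_gt0 mu0 mu0; nra.
Qed.

End ErrorBounds.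

(** * The proximal step *)

Section ProximalStep.
Context {R : realType} {n : nat}.
Variables (h : 'rV[R]_n -> \bar R) (c r q : 'rV[R]_n) (K : R).
Hypothesis h_Gamma0 : Gamma0 h.
Hypothesis q_min : is_argmin
  (fun u => ((dot (u - r) c + K / 2 * enorm (u - r) ^+ 2)%R%:E + h u)%E) q.

Lemma prox_fin_num : exists a, h q = a%:E.
Proof.
case: h_Gamma0 => hNy [u hu] _ _.
have := q_min u; have := hNy q; case: (h q) => [a| |] // _; first by exists a.
by rewrite addey // leye_eq; move: hu (hNy u); rewrite /edom /=; case: (h u).
Qed.

(** Optimality of the proximal step.  Moving from [q] towards [y] by a fraction
    [s] changes the model by a term linear in [s], controlled by the convexity of
    [h], plus [K / 2 * enorm (y - q) ^+ 2 * s ^+ 2]; minimality of [q] forces the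
    linear part to be nonnegative. *)
Lemma prox_subgradient : subdiff h q (- c - K *: (q - r)).
Proof.
case: h_Gamma0 => hNy _ _ hc; have [a qa] := prox_fin_num.
move=> y; rewrite qa; have := hNy y; case hy: (h y) => [b| |] // _; last first.
  by rewrite leey.
rewrite -EFinD lee_fin -subr_le0.
apply: (@le_of_le_small _ _ (K / 2 * enorm (y - q) ^+ 2)) => s /andP[s0 s1].
have := hc s y q; rewrite hy qa ltW // s1 => /(_ isT) h1.
have := le_trans (q_min (s *: y + (1 - s) *: q)) (leeD2l _ h1).
rewrite qa -!EFinM -!EFinD lee_fin.
have -> : s *: y + (1 - s) *: q - r = (q - r) + s *: (y - q).
  by rewrite scalerBl scalerBr scale1r addrCA addrAC.
rewrite !sqr_enorm; move: (y - q) (q - r) => d e.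
by rewrite !dot_bilinear (dotC c d) (dotC d e); nra.
Qed.

(** The subgradient inequality at [q], tested at [r], gains
    [K * enorm (q - r) ^+ 2]; the descent lemma for [psi] loses half of it. *)
Lemma prox_decrease (psi : 'rV[R]_n -> R) b : F11 K psi -> c = grad psi r ->
  h r = b%:E -> exists2 a, h q = a%:E &
  psi q + a + K / 2 * enorm (q - r) ^+ 2 <= psi r + b.
Proof.
move=> hpsi cE hr; have [a qa] := prox_fin_num; exists a => //.
have := prox_subgradient r; rewrite qa hr -EFinD lee_fin -(opprB q r).
have := descent_lemma r q hpsi; rewrite -cE !sqr_enorm.
by move: (q - r) => d; rewrite !dot_bilinear; lra.
Qed.

End ProximalStep.

(** * Lower semicontinuity of sums *)

Section LowerSemicontinuity.
Context {R : realType} {T : topologicalType}.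
Implicit Types (a b : T -> \bar R).
Local Open Scope ereal_scope.

(** A real number below [a x + b x] splits as a sum of real numbers below [a x]
    and [b x]. *)
Lemma lower_semicontinuousD a b : (forall x, -oo < a x) -> (forall x, -oo < b x) ->
  lower_semicontinuous a -> lower_semicontinuous b ->
  lower_semicontinuous (fun x => a x + b x).
Proof.
move=> aNy bNy la lb x s sx.
have [s1 [s2 [h1 h2 h12]]] : exists s1 s2 : R, [/\ s1%:E < a x, s2%:E < b x & s = (s1 + s2)%R].
  move: sx (aNy x) (bNy x); case: (a x) => [u| |] //; case: (b x) => [v| |] //.
  - rewrite -EFinD lte_fin => h _ _; exists (u - (u + v - s) / 2)%R, (v - (u + v - s) / 2)%R.
    by rewrite !lte_fin; split; lra.
  - by move=> _ _ _; exists (u - 1)%R, (s - (u - 1))%R; rewrite ltry lte_fin; split => //; lra.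
  - by move=> _ _ _; exists (s - (v - 1))%R, (v - 1)%R; rewrite ltry lte_fin; split => //; lra.
  - by move=> _ _ _; exists s, 0%R; rewrite !ltry addr0.
have [V xV hV] := la x s1 h1; have [W xW hW] := lb x s2 h2.
exists (V `&` W); first exact: filterI.
by move=> y [Vy Wy]; rewrite h12 EFinD lteD // ?hV ?hW.
Qed.

Lemma lower_semicontinuous_EFin (f : T -> R) : continuous f ->
  lower_semicontinuous (fun x => (f x)%:E).
Proof.
move=> cf; apply/lower_semicontinuousP => s.
rewrite (_ : [set x | _] = f @^-1` [set y | (s < y)%R]); last first.
  by apply/seteqP; split => x /=; rewrite lte_fin.
by apply: open_comp (@open_gt R s) => x _; exact: cf.
Qed.

Lemma lower_semicontinuous_sum (I : Type) (r : seq I) (a : I -> T -> \bar R) :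
  (forall i x, -oo < a i x) -> (forall i, lower_semicontinuous (a i)) ->
  lower_semicontinuous (fun x => \sum_(i <- r) a i x).
Proof.
move=> aNy la; elim: r => [|i r ih].
  rewrite (_ : (fun x => _) = fun x => 0%R%:E).
    by apply: lower_semicontinuous_EFin => x; exact: cst_continuous.
  by apply/funext => x; rewrite big_nil.
rewrite (_ : (fun x => _) = fun x => a i x + \sum_(j <- r) a j x); last first.
  by apply/funext => x; rewrite big_cons.
apply: lower_semicontinuousD => // x.
apply: (big_ind (fun u => -oo < u)) => [|u v|//]; first by rewrite ltNyr.
by move: u v => [u| |] [v| |] // _ _; rewrite -EFinD ltNyr.
Qed.

End LowerSemicontinuity.

Lemma lower_semicontinuous_comp {R : realType} (S T : topologicalType)
    (f : S -> T) (a : T -> \bar R) :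
  continuous f -> lower_semicontinuous a -> lower_semicontinuous (a \o f).
Proof.
move=> cf la x s /la [V fxV hV]; exists (f @^-1` V); first exact: cf.
by move=> y; exact: hV.
Qed.

(** * Vectors made of blocks *)

Section BlockAlgebra.
Context {R : realType} {p : nat} {dd : 'I_p -> nat}.
Local Notation Rd := 'rV[R]_(\sum_(j < p) dd j).
Implicit Types (x y u v : Rd) (j k : 'I_p).

Lemma dot_blocks u v : dot u v = \sum_j dot (submxrow u j) (submxrow v j).
Proof.
by rewrite -{1}(submxrowK u) -{1}(submxrowK v) /dot tr_mxrow mul_mxrow_mxcol summxE.
Qed.

Lemma dot_block_le u j : dot (submxrow u j) (submxrow u j) <= dot u u.
Proof.
by rewrite [leRHS]dot_blocks (bigD1 j) //= lerDl sumr_ge0 // => k _; exact: dot_ge0.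
Qed.

Lemma submxrowZ (a : R) u j : submxrow (a *: u) j = a *: submxrow u j.
Proof. by apply/matrixP => i k; rewrite !mxE. Qed.

Lemma continuous_submxrow j : continuous (fun x : Rd => submxrow x j).
Proof.
move=> x A /nbhs_ballP[e e0 eA]; apply/nbhs_ballP; exists e => // y [_ xy].
by apply: eA; split => // i k; rewrite !mxE; exact: xy.
Qed.

Lemma splice_block y x j (w : 'rV[R]_(dd j)) : submxrow (splice y x w) j = w.
Proof. by rewrite /splice mxrowK dfwith_in. Qed.

Lemma splice_block_out y x j (w : 'rV[R]_(dd j)) k : j != k ->
  submxrow (splice y x w) k = if (k < j)%N then submxrow y k else submxrow x k.
Proof. by move=> jk; rewrite /splice mxrowK dfwith_out. Qed.

(** [splice y x] is affine in the spliced block, with the embedding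
    [splice 0 0] of that block as its linear part. *)
Lemma spliceD y x j (w e : 'rV[R]_(dd j)) :
  splice y x (w + e) = splice y x w + splice 0 0 e.
Proof.
apply/mxrowP => k; rewrite submxrowD; have [<-|jk] := eqVneq j k.
  by rewrite !splice_block.
by rewrite !splice_block_out // !submxrow0 if_same addr0.
Qed.

Lemma spliceZ (a : R) j (e : 'rV[R]_(dd j)) : splice 0 0 (a *: e) = a *: splice 0 0 e.
Proof.
apply/mxrowP => k; rewrite submxrowZ; have [<-|jk] := eqVneq j k.
  by rewrite !splice_block.
by rewrite !splice_block_out // !submxrow0 if_same scaler0.
Qed.

Lemma dot_splice0 u j (e : 'rV[R]_(dd j)) : dot u (splice 0 0 e) = dot (submxrow u j) e.
Proof.
rewrite dot_blocks (bigD1 j) //= splice_block big1 ?addr0 // => k kj.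
by rewrite splice_block_out ?(eq_sym j) // !submxrow0 if_same dot0r.
Qed.

Lemma dot_inj n (a b : 'rV[R]_n) : (forall e, dot a e = dot b e) -> a = b.
Proof.
move=> ab; apply/eqP; rewrite -subr_eq0; apply/eqP/dot_self_eq0.
by rewrite dotDl dotNl ab subrr.
Qed.

(** Both sides represent the directional derivatives of [f] along the [j]-th
    block. *)
Lemma grad_splice (f : Rd -> R) y x j (w : 'rV[R]_(dd j)) :
  differentiable f (splice y x w) ->
  differentiable (fun e => f (splice y x e)) w ->
  grad (fun e => f (splice y x e)) w = submxrow (grad f (splice y x w)) j.
Proof.
move=> df dpsi; apply: dot_inj => e.
rewrite -derive_dot_grad // -dot_splice0 -derive_dot_grad // /derive.
suff -> : (fun t : R => t^-1 *: (((fun e => f (splice y x e)) \o shift w) (t *: e) -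
    f (splice y x w))) = (fun t => t^-1 *: ((f \o shift (splice y x w))
    (t *: splice 0 0 e) - f (splice y x w))) by [].
by apply/funext => t /=; rewrite [t *: e + w]addrC spliceD spliceZ [_ + splice _ _ w]addrC.
Qed.

(** The iterate in the middle of a sweep from [x] to [y], when [k] blocks have
    been updated. *)
Definition mix y x (k : nat) : Rd :=
  \mxrow_(i < p) (if (i < k)%N then submxrow y i else submxrow x i).

Lemma mix0 y x : mix y x 0 = x.
Proof. by apply/mxrowP => k; rewrite mxrowK. Qed.

Lemma mix_all y x : mix y x p = y.
Proof. by apply/mxrowP => k; rewrite mxrowK ltn_ord. Qed.

Lemma splice_old y x j : splice y x (submxrow x j) = mix y x j.
Proof.
apply/mxrowP => k; rewrite [RHS]mxrowK; have [<-|jk] := eqVneq j k.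
  by rewrite splice_block ltnn.
by rewrite splice_block_out.
Qed.

Lemma splice_new y x j : splice y x (submxrow y j) = mix y x j.+1.
Proof.
apply/mxrowP => k; rewrite [RHS]mxrowK; have [<-|jk] := eqVneq j k.
  by rewrite splice_block ltnSn.
by rewrite splice_block_out // ltnS [(k <= j)%N]leq_eqVlt (inj_eq val_inj) eq_sym (negbTE jk).
Qed.

(** Only the blocks other than [j] of the background matter, so the partial
    functions met during a sweep are partial functions around a single point. *)
Lemma splice_mix y x j (w : 'rV[R]_(dd j)) :
  splice y x w = splice (mix y x j) (mix y x j) w.
Proof.
apply/mxrowP => k; have [<-|jk] := eqVneq j k; first by rewrite !splice_block.
by rewrite !splice_block_out // mxrowK if_same.
Qed.

Lemma dot_sub_mix_le y x k :
  dot (y - mix y x k) (y - mix y x k) <= dot (y - x) (y - x).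
Proof.
rewrite !dot_blocks; apply: ler_sum => i _.
rewrite !submxrowB mxrowK; case: ifP => // _.
by rewrite subrr dot0l dot_ge0.
Qed.

End BlockAlgebra.

(** * The composite objective *)

Section Composite.
Context {R : realType} {p : nat} {dd : 'I_p -> nat}.
Local Notation Rd := 'rV[R]_(\sum_(j < p) dd j).
Variables (f : Rd -> R) (g : forall j, 'rV[R]_(dd j) -> \bar R).
Arguments g : clear implicits.
Implicit Types (x y : Rd) (L : R) (Lb : 'I_p -> R).
Local Notation phi := (composite f g).
Hypothesis gG : forall j, Gamma0 (g j).

Lemma composite_lsc : continuous f -> lower_semicontinuous phi.
Proof.
move=> cf; apply: lower_semicontinuousD => [x|x||].
- by rewrite ltNyr.
- apply: (big_ind (fun u => -oo < u)%E) => [|u v|j _]; first by rewrite ltNyr.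
    by move: u v => [u| |] [v| |] // _ _; rewrite -EFinD ltNyr.
  by case: (gG j).
- exact: lower_semicontinuous_EFin.
apply: (lower_semicontinuous_sum (a := fun j x => g j (submxrow x j))) => j.
  by move=> x; case: (gG j).
case: (gG j) => _ _ lsc _.
exact: lower_semicontinuous_comp (@continuous_submxrow _ _ _ j) lsc.
Qed.

(** No [g j] takes the value [-oo], so one infinite term would make the sum
    infinite. *)
Lemma composite_fin x : (phi x < +oo)%E -> forall j, g j (submxrow x j) \is a fin_num.
Proof.
move=> xy j; have gNy i : g i (submxrow x i) != -oo%E.
  by case: (gG i) => /(_ (submxrow x i)) + _ _ _; case: (g i _).
apply/fin_numP; split => //; apply/eqP => gy; move: xy.
have sNy : (\sum_(i < p | i != j) g i (submxrow x i) != -oo)%E.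
  rewrite esum_eqNy; apply/negP => /existsP[i /andP[_ /eqP giNy]].
  by have := gNy i; rewrite giNy.
by rewrite /composite (bigD1 j) //= gy addye // addey.
Qed.

Lemma compositeE x : (phi x < +oo)%E ->
  phi x = (f x + \sum_j fine (g j (submxrow x j)))%:E.
Proof.
move=> /composite_fin xfin; rewrite EFinD -sumEFin; congr (_ + _)%E.
by apply: eq_bigr => j _; rewrite fineK.
Qed.

Lemma composite_min_fin xm : is_argmin phi xm -> exists m, phi xm = m%:E.
Proof.
move=> xm_min.
have dom j : exists w, (g j w < +oo)%E by case: (gG j).
pose w j := sval (cid (dom j)).
suff /compositeE -> : (phi xm < +oo)%E by eexists.
apply: le_lt_trans (xm_min (\mxrow_j w j)) _.
rewrite /composite lte_add_pinfty ?ltry // lte_sum_pinfty // => j _.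
by rewrite mxrowK /w; case: (cid (dom j)).
Qed.

Lemma composite_subgradient L y (v : forall j, 'rV[R]_(dd j)) : F11 L f ->
  (forall j, subdiff (g j) (submxrow y j) (v j)) ->
  subdiff phi y (grad f y + \mxrow_j v j).
Proof.
move=> hf hv z.
rewrite dotDl EFinD addeACA leeD //.
  by rewrite -EFinD lee_fin; exact: gradient_inequality hf.
rewrite dot_blocks -sumEFin -big_split /=; apply: lee_sum => j _.
by rewrite mxrowK submxrowB; exact: hv.
Qed.

End Composite.

(** * One sweep of the algorithm *)

Section Sweep.
Context {R : realType} {p : nat} {dd : 'I_p -> nat}.
Local Notation Rd := 'rV[R]_(\sum_(j < p) dd j).
Variables (f : Rd -> R) (g : forall j, 'rV[R]_(dd j) -> \bar R).
Arguments g : clear implicits.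
Variables (L : R) (Lb : 'I_p -> R) (x y : Rd).
Local Notation phi := (composite f g).
Hypothesis hfg : composite_problem f g L Lb.
Hypothesis xfin : (phi x < +oo)%E.
Hypothesis y_step : forall j,
    let psi (u : 'rV[R]_(dd j)) := f (splice y x u) in
    let xj := submxrow x j in
    is_argmin
      (fun u => ((dot (u - xj) (grad psi xj)
                  + Lb j / 2 * enorm (u - xj) ^+ 2)%R%:E + g j u)%E)
      (submxrow y j).

Let gG j : Gamma0 (g j). Proof. by case: hfg. Qed.

Let hf : F11 L f. Proof. by case: hfg. Qed.

Lemma splice_F11 j : F11 (Lb j) (fun w : 'rV[R]_(dd j) => f (splice y x w)).
Proof.
rewrite (_ : (fun w => _) = fun w => f (splice (mix y x j) (mix y x j) w)).
  by case: hfg.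
by apply/funext => w; rewrite splice_mix.
Qed.

Lemma block_decrease j : exists2 a, g j (submxrow y j) = a%:E &
  f (mix y x j.+1) + a + Lb j / 2 * enorm (submxrow y j - submxrow x j) ^+ 2
    <= f (mix y x j) + fine (g j (submxrow x j)).
Proof.
have [a ya] := prox_decrease (@gG j) (@y_step j) (@splice_F11 j) erefl
  (esym (fineK (composite_fin gG xfin j))).
by rewrite splice_new splice_old => h; exists a.
Qed.

Lemma sweep_fin : (phi y < +oo)%E.
Proof.
rewrite /composite lte_add_pinfty ?ltry // lte_sum_pinfty // => j _.
by have [a -> _] := @block_decrease j; rewrite ltry.
Qed.

(** The block decreases telescope along [mix y x 0 = x] to [mix y x p = y]. *)
Lemma sweep_decrease (lmin : R) : (forall j, lmin <= Lb j) ->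
  fine (phi y) + lmin / 2 * dot (y - x) (y - x) <= fine (phi x).
Proof.
move=> lminP.
rewrite (compositeE gG xfin) (compositeE gG sweep_fin) /=.
have h : \sum_(j < p) (f (mix y x j.+1) - f (mix y x j)) = f y - f x.
  by rewrite -(big_mkord xpredT (fun j => f (mix y x j.+1) - f (mix y x j)))
    telescope_sumr // mix0 mix_all.
have : \sum_(j < p) (f (mix y x j.+1) - f (mix y x j)) +
   \sum_(j < p) fine (g j (submxrow y j)) +
   \sum_(j < p) (lmin / 2 * dot (submxrow (y - x) j) (submxrow (y - x) j)) <=
   \sum_(j < p) fine (g j (submxrow x j)).
  rewrite -!big_split /=; apply: ler_sum => j _.
  have [a -> /=] := @block_decrease j; rewrite sqr_enorm submxrowB.
  have := ler_wpM2r (dot_ge0 (submxrow y j - submxrow x j)) (lminP j).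
  by lra.
by rewrite h -mulr_sumr -dot_blocks; lra.
Qed.

(** Each block is estimated by [|a - b|^2 <= 2 |a|^2 + 2 |b|^2], where [a] is a
    block of a difference of gradients and [b] a multiple of the displacement of
    the block.  Bounding each [|a|^2] by the full difference of gradients
    produces the factor [p] when the blocks are added. *)
Lemma sweep_subgradient (lmax : R) : (forall j, 0 < Lb j <= lmax) -> 0 < L ->
  exists2 v, subdiff phi y v &
    dot v v <= (2 * p%:R * L ^+ 2 + 2 * lmax ^+ 2) * dot (y - x) (y - x).
Proof.
move=> lmaxP L0.
pose c j := grad (fun w : 'rV[R]_(dd j) => f (splice y x w)) (submxrow x j).
pose w j := - c j - Lb j *: (submxrow y j - submxrow x j).
exists (grad f y + \mxrow_j w j).
  apply: composite_subgradient hf _ => j.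
  exact: prox_subgradient (@gG j) (@y_step j).
have cE j : c j = submxrow (grad f (mix y x j)) j.
  have [_ df _] := hf; have [_ dpsi _] := @splice_F11 j.
  by rewrite /c grad_splice // splice_old.
set D := dot (y - x) (y - x).
have blk j : dot (submxrow (grad f y + \mxrow_j w j) j) (submxrow (grad f y + \mxrow_j w j) j)
  <= 2 * L ^+ 2 * D + 2 * lmax ^+ 2 * dot (submxrow (y - x) j) (submxrow (y - x) j).
  have [_ _ lip] := hf.
  have L1 : dot (grad f y - grad f (mix y x j)) (grad f y - grad f (mix y x j)) <= L ^+ 2 * D.
    apply: (@le_trans _ _ (L ^+ 2 * dot (y - mix y x j) (y - mix y x j))).
      rewrite -!sqr_enorm -exprMn lerXn2r // nnegrE ?enorm_ge0 //.
      by rewrite mulr_ge0 ?enorm_ge0 // ltW.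
    by rewrite ler_wpM2l ?sqr_ge0 // dot_sub_mix_le.
  have := le_trans (dot_block_le (grad f y - grad f (mix y x j)) j) L1.
  have L2 : Lb j ^+ 2 <= lmax ^+ 2.
    have /andP[l0 l1] := lmaxP j.
    by rewrite lerXn2r // nnegrE ltW // (lt_le_trans l0).
  have := ler_wpM2r (dot_ge0 (submxrow (y - x) j)) L2.
  rewrite [submxrow (grad f y + _) j]submxrowD mxrowK /w cE addrA -!submxrowB.
  move: (submxrow _ j) (submxrow (y - x) j) => a b.
  have := dot_ge0 (a + Lb j *: b); rewrite !dot_bilinear (dotC b a); lra.
rewrite dot_blocks (le_trans (ler_sum _ (fun j _ => blk j))) //.
rewrite big_split /= sumr_const card_ord -mulr_sumr -dot_blocks -/D -[_ *+ p]mulr_natl.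
by rewrite [leLHS](_ : _ = (2 * p%:R * L ^+ 2 + 2 * lmax ^+ 2) * D) //; ring.
Qed.

End Sweep.

(** * The linear rate *)

Section Rate.
Context {R : realType} {p : nat} {dd : 'I_p -> nat}.
Local Notation Rd := 'rV[R]_(\sum_(j < p) dd j).
Variables (hp : (0 < p)%N) (f : Rd -> R) (g : forall j, 'rV[R]_(dd j) -> \bar R).
Variables (L : R) (Lb : 'I_p -> R) (Omega : set Rd) (x : nat -> Rd).
Local Notation phi := (composite f g).
Hypotheses (hL : 0 < L) (hLb : forall j, 0 < Lb j).
Hypothesis hfg : composite_problem f g L Lb.
Hypothesis hOmega : Omega `<=` dom_subdiff phi.
Hypotheses (hx : palm f g Lb x) (hxOmega : forall t, Omega (x t)).

Lemma palm_linear_rate (eta : R) : 0 < eta -> res_obj_EB phi eta Omega ->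
  forall t, (phi (x t.+1) - minval phi
    <= (palm_factor hp L Lb eta)%:E * (phi (x t) - minval phi))%E.
Proof.
move=> eta0 EB t; have [_ gG _ [xm xm_min]] := hfg.
have [m xmE] := composite_min_fin gG xm_min.
have [r0 x0E mr0] := dom_subdiff_fin xm_min xmE (hOmega (hxOmega t)).
have [r1 x1E mr1] := dom_subdiff_fin xm_min xmE (hOmega (hxOmega t.+1)).
have x0fin : (phi (x t) < +oo)%E by rewrite x0E ltry.
rewrite (minval_argmin xm_min xmE) x0E x1E -!EFinB -EFinM lee_fin.
pose D := dot (x t.+1 - x t) (x t.+1 - x t).
have lminP j : Lmin hp Lb <= Lb j by exact: bigmin_le.
have lmaxP j : 0 < Lb j <= Lmax hp Lb by rewrite hLb; exact: le_bigmax.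
have lmin0 : 0 < Lmin hp Lb by apply: lt_bigmin.
have lmax0 : 0 < Lmax hp Lb by have /andP[l0 l1] := lmaxP (Ordinal hp); exact: lt_le_trans l1.
have decr : r1 + Lmin hp Lb / 2 * D <= r0.
  by have := sweep_decrease hfg x0fin (hx t) lminP; rewrite x0E x1E.
have [v vx vD] := sweep_subgradient hfg (hx t) lmaxP hL.
have [_ gmin] := subgrad0P xm_min xmE (hOmega (hxOmega t.+1)).
have resid : eta ^+ 2 * (r1 - m) <= (2 * p%:R * L ^+ 2 + 2 * Lmax hp Lb ^+ 2) * D.
  apply: le_trans vD.
  have /(res_obj_EB_sqr xm_min xmE (ltW eta0) hOmega) h := EB.
  apply: le_trans (h _ _ (hxOmega t.+1) x1E) _.
  by rewrite -sqr_enorm lerXn2r // ?nnegrE ?enorm_ge0 // gmin.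
rewrite /palm_factor; set B := _ + 4 * _.
have B0 : 0 < B.
  apply: ltr_wpDl; last by rewrite mulr_gt0 // exprn_gt0.
  by rewrite mulr_ge0 ?sqr_ge0 // mulr_ge0 ?ler0n.
have resid' : eta ^+ 2 * (r1 - m) <= B / 2 * D.
  by apply: le_trans resid _; rewrite /B; lra.
have q0 : 0 <= eta ^+ 2 * Lmin hp Lb / B.
  by rewrite divr_ge0 ?(ltW B0) // mulr_ge0 ?sqr_ge0 // ltW.
rewrite ler_pdivlMl; last by rewrite ltr_wpDl.
suff : eta ^+ 2 * Lmin hp Lb / B * (r1 - m) <= r0 - r1 by lra.
rewrite mulrAC ler_pdivrMr //.
have h1 := ler_wpM2l (ltW lmin0) resid'.
have h2 := ler_wpM2l (ltW B0) decr.
by lra.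
Qed.

End Rate.

(** * A problem without strong convexity *)

Section ZeroProblem.
Context {R : realType} {p : nat} {dd : 'I_p -> nat}.
Local Notation Rd := 'rV[R]_(\sum_(j < p) dd j).
Let f0 : Rd -> R := fun=> 0.
Let g0 j : 'rV[R]_(dd j) -> \bar R := fun=> 0%E.

Lemma F11_zero n (L : R) : 0 <= L -> F11 L (fun _ : 'rV[R]_n => 0).
Proof.
move=> L0; split => [t u v _ _|u|u v].
- by rewrite convRE !mulr0 addr0.
- exact: differentiable_cst.
- have g0E w : grad (fun _ : 'rV[R]_n => 0 : R) w = 0.
    by apply/rowP => i; rewrite !mxE derive_cst.
  by rewrite !g0E subrr /enorm dot0l sqrtr0 mulr_ge0 // sqrtr_ge0.
Qed.

Lemma Gamma0_zero n : Gamma0 (fun _ : 'rV[R]_n => 0%E).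
Proof.
split => [u||u a h|t u v _].
- by rewrite ltNyr.
- by exists 0; rewrite /edom /= ltry.
- by exists setT => //; exact: filterT.
- by rewrite !mule0 adde0.
Qed.

Lemma composite_zero : composite f0 g0 = fun=> 0%E.
Proof. by apply/funext => u; rewrite /composite big1 // adde0. Qed.

Lemma composite_problem_zero (L : R) (Lb : 'I_p -> R) : 0 < L -> (forall j, 0 < Lb j) ->
  composite_problem f0 g0 L Lb.
Proof.
move=> L0 Lb0; split => [|j|u j|].
- exact: F11_zero (ltW L0).
- exact: Gamma0_zero.
- exact: F11_zero (ltW (Lb0 j)).
- by exists 0 => u; rewrite composite_zero.
Qed.

Lemma res_obj_EB_zero (eta : R) (Omega : set Rd) : res_obj_EB (composite f0 g0) eta Omega.
Proof.
move=> u _; rewrite composite_zero (@minval_argmin _ _ _ 0 0) //.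
by rewrite sube0 sqrte0 mule0 lee_fin enorm_ge0.
Qed.

(** The strong convexity inequality fails at the midpoint of two distinct points,
    which exist because some block has positive dimension. *)
Lemma not_strongly_convex_zero (mu : R) : (exists j, (0 < dd j)%N) -> 0 < mu ->
  ~ strongly_convex mu (composite f0 g0).
Proof.
move=> [j dj] mu0; rewrite composite_zero => sc.
have h01 : 0 <= (2^-1 : R) <= 1 by apply/andP; split; lra.
have := sc 2^-1 (const_mx 1) 0 h01.
rewrite !mule0 !add0e lee_fin subr0 sqr_enorm dotE.
rewrite (eq_bigr (fun=> 1)) => [|i _]; last by rewrite !mxE mulr1.
rewrite sumr_const card_ord.
have : (0 : R) < (\sum_(j < p) dd j)%:R.
  by rewrite ltr0n (bigD1 j) //= addn_gt0 dj.
move: (_%:R) => N N0; nra.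
Qed.

End ZeroProblem.

(** * Convergence of PALM *)

Theorem theorem3 (R : realType) (p : nat) (hp : (0 < p)%N) (dd : 'I_p -> nat)
    (f : 'rV[R]_(\sum_(j < p) dd j) -> R)
    (g : forall j : 'I_p, 'rV[R]_(dd j) -> \bar R)
    (L : R) (Lb : 'I_p -> R)
    (Omega : set 'rV[R]_(\sum_(j < p) dd j))
    (hL : 0 < L) (hLb : forall j, 0 < Lb j)
    (hfg : composite_problem f g L Lb)
    (hOmega : Omega `<=` dom_subdiff (composite f g))
    (x : nat -> 'rV[R]_(\sum_(j < p) dd j))
    (hx : palm f g Lb x) (hxOmega : forall t, Omega (x t)) :
  let phi := composite f g in
  let rate eta := forall t,
    (phi (x t.+1) - minval phi
       <= (palm_factor hp L Lb eta)%:E * (phi (x t) - minval phi))%E in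
  [/\ (* linear convergence under (res-obj-EB) *)
      forall eta, 0 < eta -> res_obj_EB phi eta Omega -> rate eta,
      (* linear convergence under one of the equivalent conditions *)
      subdiff_invariant phi Omega ->
        [\/ exists2 nu, 0 < nu & cor_EB phi nu Omega,
            exists2 kappa, 0 < kappa & res_EB phi kappa Omega
          | exists2 alpha, 0 < alpha & obj_EB phi alpha Omega] ->
        exists eta, [/\ 0 < eta, res_obj_EB phi eta Omega & rate eta],
      (* strong convexity implies (res-obj-EB) *)
      (exists2 mu, 0 < mu & strongly_convex mu phi) ->
        exists2 eta, 0 < eta & res_obj_EB phi eta Omega
    & (* but is not implied by it *)
      (exists j, (0 < dd j)%N) ->
        exists (f' : 'rV[R]_(\sum_(j < p) dd j) -> R)
               (g' : forall j : 'I_p, 'rV[R]_(dd j) -> \bar R),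
        let phi' := composite f' g' in
        [/\ composite_problem f' g' L Lb,
            exists2 eta, 0 < eta & res_obj_EB phi' eta (dom_subdiff phi')
          & ~ exists2 mu, 0 < mu & strongly_convex mu phi']].
Proof.
move=> phi rate.
have rateP eta : 0 < eta -> res_obj_EB phi eta Omega -> rate eta.
  exact: palm_linear_rate.
have [[_ df _] gG _ [xm xm_min]] := hfg.
have [m xmE] := composite_min_fin gG xm_min.
have lsc : lower_semicontinuous phi.
  by apply: composite_lsc gG _ => u; exact: differentiable_continuous.
have res_rate kappa : 0 < kappa -> res_EB phi kappa Omega ->
    exists eta, [/\ 0 < eta, res_obj_EB phi eta Omega & rate eta].
  move=> k0 /(res_EB_res_obj_EB xm_min xmE lsc hOmega k0) EB.
  by exists (Num.sqrt kappa); split; rewrite ?sqrtr_gt0 //; apply: rateP; rewrite ?sqrtr_gt0.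
split => //.
- move=> _ [[nu nu0 /(cor_EB_res_EB xm_min xmE lsc hOmega)]|[kappa k0]|[alpha a0 EB]].
  + exact: res_rate.
  + exact: res_rate.
  have {}EB := obj_EB_res_obj_EB xm_min xmE lsc hOmega a0 EB.
  have s0 : 0 < Num.sqrt (alpha / 2) by rewrite sqrtr_gt0 divr_gt0.
  by exists (Num.sqrt (alpha / 2)); split => //; exact: rateP.
- move=> [mu mu0 sc]; exists (Num.sqrt mu); first by rewrite sqrtr_gt0.
  exact: (strongly_convex_res_obj_EB xm_min xmE hOmega mu0 sc).
- move=> dpos; exists (fun=> 0), (fun _ _ => 0%E); split.
  + exact: composite_problem_zero.
  + by exists 1 => //; exact: res_obj_EB_zero.
  + by move=> [mu mu0]; exact: not_strongly_convex_zero.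
Qed.
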